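(* Let $2\leq s<\infty$ and let $(n_k)_{k\ge 0}$ be a lacunary sequence. Then there exists a constant $C>0$ such that $$\|\mathcal{V}_sf\|_{L^1(\mathbb{R})}\leq C\|f\|_{H^1(\mathbb{R})}$$ for all $f\in H^1(\mathbb{R})$.
   Context: An increasing sequence $(n_k)_{k\geq 0}$ of real numbers is called lacunary if there exists a constant $\beta>1$ such that $n_{k+1}/n_k\geq\beta$ for all $k=0,1,2,\dots$ (so all $n_k>0$). For a locally integrable function $f$ on $\mathbb{R}$ put $$A_{n_k}f(x)=\frac{1}{n_k}\int_0^{n_k}f(x-t)\,dt,\qquad \mathcal{V}_sf(x)=\left(\sum_{k=1}^\infty|A_{n_k}f(x)-A_{n_{k-1}}f(x)|^s\right)^{1/s}.$$ $H^1(\mathbb{R})$ denotes the (real) Hardy space on $\mathbb{R}$. *)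

(* Defs.v *)
From HB Require Import structures.
From mathcomp Require Import all_boot all_order all_algebra.
From mathcomp Require Import all_classical all_reals all_analysis.

Set Implicit Arguments.
Unset Strict Implicit.
Unset Printing Implicit Defensive.

Import Order.TTheory GRing.Theory Num.Theory.
Import numFieldNormedType.Exports.

Local Open Scope classical_set_scope.
Local Open Scope ring_scope.

(* Positivity of the terms is not assumed: see [lacunary_gt0]. *)
Definition lacunary (R : realType) (n : R^nat) : Prop :=
  increasing_seq n /\ exists2 beta : R, 1 < beta & forall k, beta <= n k.+1 / n k.

Lemma lacunary_gt0 (R : realType) (n : R^nat) (k : nat) : lacunary n -> 0 < n k.
Proof.
move=> [inc [beta beta1 ratio]].
have lt_n : n k < n k.+1 by rewrite (leW_mono inc) ltEnat /=.
have := lt_le_trans beta1 (ratio k).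
have [n0|n0|->] := ltrgtP (n k) 0; last by rewrite invr0 mulr0 ltr10.
  by rewrite ltr_ndivlMr// mul1r => /(lt_trans lt_n); rewrite ltxx.
by [].
Qed.

Definition backward_average (R : realType) (r : R) (f : R -> R) (x : R) : R :=
  r^-1 * \int[lebesgue_measure]_(t in `[0, r]) f (x - t).

(* Extended-real valued: the series of nonnegative terms may diverge. *)
Definition variation_operator (R : realType) (s : R) (n : R^nat) (f : R -> R) (x : R)
    : \bar R :=
  ((\sum_(1 <= k <oo)
      (`|backward_average (n k) f x - backward_average (n k.-1) f x| `^ s)%:E) `^ s^-1)%E.

(* The Hardy space H^1(R) is taken in its atomic (Coifman-Weiss) form, with
   real-valued (1, oo)-atoms. *)
Definition H1_atom (R : realType) (a : R -> R) : Prop :=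
  measurable_fun setT a /\
  exists u v : R, [/\ u < v,
    forall x, x \notin `[u, v] -> a x = 0,
    ('N[lebesgue_measure]_(+oo) [EFin \o a] <= ((v - u)^-1)%:E)%E &
    \int[lebesgue_measure]_x a x = 0].

(* f = \sum_j lam_j a_j, the series converging in L^1(R). *)
Definition atomic_decomposition (R : realType) (f : R -> R)
    (lam : R^nat) (a : nat -> R -> R) : Prop :=
  (forall j, H1_atom (a j)) /\
  (fun N => 'N[lebesgue_measure]_1
     [(fun x => (f x - \sum_(0 <= j < N) lam j * a j x)%:E)]%E) @ \oo --> 0%E.

(* The infimum over the empty set is +oo. *)
Definition H1_norm (R : realType) (f : R -> R) : \bar R :=
  ereal_inf [set c | exists lam a, atomic_decomposition f lam a /\
                       c = (\sum_(0 <= j <oo) `|lam j|%:E)%E].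

Definition in_H1 (R : realType) (f : R -> R) : Prop :=
  lebesgue_measure.-integrable setT (EFin \o f) /\ (H1_norm f < +oo)%E.

(* Main.v *)
Require Import Defs.
From HB Require Import structures.
From mathcomp Require Import all_boot all_order all_algebra.
From mathcomp Require Import all_classical all_reals all_analysis.
From mathcomp Require Import measurable_realfun ess_sup_inf ring lra.

Set Implicit Arguments.
Unset Strict Implicit.
Unset Printing Implicit Defensive.

Import Order.TTheory GRing.Theory Num.Theory.
Import numFieldNormedType.Exports.

Local Open Scope classical_set_scope.
Local Open Scope ring_scope.

(** Every atomic decomposition of [f] converges in L^1, and for a fixed point [x] and a fixed
    scale the average at [x] is a continuous functional on L^1. Minkowski's inequality in l^s
    therefore bounds the variation of [f] at [x] by the sum of the variations of the atoms with
    weights [`|lam j|] ([variation_atomic_decomposition]), and it remains to bound the variation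
    of an atom in L^1, uniformly ([integral_variation_atom_le]).

    Let [a] be an atom on [[u, v]] and [L = v - u]. Left of [u] all its averages vanish. On
    [[u, v + L]] the l^s norm is at most the l^2 norm [V_2], and [V_2 <= 1 / L + L * V_2 ^ 2];
    the integral of [V_2 ^ 2] is at most a constant times the squared L^2 norm of [a], which is
    at most [1 / L]. Beyond [v + L] the l^s norm is at most the l^1 norm; since [a] has mean zero,
    its average at scale [r] lives there on [[u + r, v + r]], where it is at most [1 / r], and it
    vanishes if [r <= L]. The integrals of these tails are [L / n k] for the scales [n k] above
    [L], and they form a geometric sum ([lacunary_sum_inv_le]).

    The L^2 bound ([lacunary_square_function_bound]) is proved without the Fourier transform, by
    almost orthogonality ([almost_orthogonality]). Let [T_k] be the convolution with the
    difference of two consecutive averaging kernels. Averaging a function bounded by [M] over a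
    window of length [s] makes it Lipschitz with constant [2 M / s], and averaging a [K]-Lipschitz
    function at scale [r] moves it by at most [K r]; hence [T_j^* T_k], acting on bounded
    functions, has norm at most a constant times [q ^+ |j - k|], where [1 / q] is the lacunarity
    constant. As convolutions commute, the vectors [T_k^* T_k f] then have inner products at most
    such a multiple of the mean of the squared norms of [T_j f] and [T_k f], and expanding the
    square of [B f - \sum_k T_k^* T_k f] gives the bound. All of this takes place in the algebra
    of bounded functions of bounded support under convolution, where inner products are values of
    convolutions at the origin. *)

(** * Reflection of the line and functions of bounded support *)

Section reflection.
Context {R : realType}.
Local Notation mu := (@lebesgue_measure R).

Lemma measurable_reflect (c : R) : measurable_fun [set: R] (fun t : R => c - t).
Proof. exact: measurable_funB. Qed.

Lemma lebesgue_measure_reflect (c : R) (A : set R) : measurable A ->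
  pushforward mu ((fun t => c - t) : R -> measurableTypeR R) A = mu A.
Proof.
have mr := measurable_reflect c.
move=> mA; apply/esym/lebesgue_measure_unique => //= _ [[a b]] _ <-.
rewrite /pushforward /=.
have -> : (fun t => c - t) @^-1` `]a, b]%classic = `[c - b, c - a[%classic.
  by apply/seteqP; split => t /=; rewrite !in_itv/= => /andP[h1 h2]; apply/andP; split; lra.
rewrite !lebesgue_measure_itv/= !lte_fin.
have -> : (c - b < c - a) = (a < b) by apply/idP/idP => ?; lra.
by case: ifP => // _; rewrite -!EFinB; congr EFin; lra.
Qed.

Lemma ge0_integral_reflect (c : R) (f : R -> \bar R) :
  measurable_fun [set: R] f -> (forall x, 0 <= f x)%E ->
  (\int[mu]_t f (c - t)%R = \int[mu]_t f t)%E.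
Proof.
move=> mf f0.
have := @ge0_integral_pushforward _ _ (measurableTypeR R) (measurableTypeR R) R _
  (measurable_reflect c) mu setT f measurableT mf (fun y _ => f0 y).
rewrite preimage_setT => <-.
have mr := measurable_reflect c.
by apply: eq_measure_integral => //= A mA _; exact: lebesgue_measure_reflect.
Qed.

Lemma integral_reflect (c : R) (f : R -> \bar R) : measurable_fun [set: R] f ->
  (\int[mu]_t f (c - t)%R = \int[mu]_t f t)%E.
Proof.
move=> mf; rewrite integralE [RHS]integralE; congr (_ - _)%E.
  rewrite -(ge0_integral_reflect c (measurable_funepos mf))//.
  by apply: eq_integral => x _; rewrite !funeposE.
rewrite -(ge0_integral_reflect c (measurable_funeneg mf))//.
by apply: eq_integral => x _; rewrite !funenegE.
Qed.

Lemma Rintegral_reflect (c : R) (f : R -> R) : measurable_fun [set: R] f ->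
  \int[mu]_t f (c - t) = \int[mu]_t f t.
Proof.
move=> mf; rewrite /Rintegral.
by rewrite -(integral_reflect c (f := EFin \o f))//; exact/measurable_EFinP.
Qed.

End reflection.

Section bcs.
Context {R : realType}.
Local Notation mu := (@lebesgue_measure R).
Implicit Types (f g h : R -> R).

(** Bounded Borel functions vanishing outside a bounded set. On this class convolution is
    defined everywhere, commutative and associative. A single [M] bounds the values and the
    support. *)
Definition bcs f := measurable_fun [set: R] f /\
  exists M : R, (forall x, `|f x| <= M) /\ (forall x, M < `|x| -> f x = 0).

Lemma bcs_meas f : bcs f -> measurable_fun [set: R] f.
Proof. by case. Qed.

Lemma bcs_integrable f : bcs f -> mu.-integrable setT (EFin \o f).
Proof.
move=> [mf [M [fM f0]]].
have fE : (EFin \o f) = (EFin \o f) \_ `[-M, M].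
  apply/funext => x; rewrite patchE; case: ifPn => //=.
  rewrite notin_setE/= in_itv/= -ler_norml => /negP; rewrite -ltNge => /f0 ->//.
rewrite fE.
apply: (proj1 (@integrable_mkcond _ (measurableTypeR R) R mu `[-M, M]%classic _ _)) => //.
apply: measurable_bounded_integrable => //.
- by rewrite /= lebesgue_measure_itv/=; case: ifP; rewrite ?ltry// -EFinB ltry.
- exact: measurable_funTS.
- exists M; split; first exact: num_real.
  by move=> N MN x _; apply: (le_trans (fM x)); exact: ltW.
Qed.

(** The reflection [x |-> f (- x)]; convolution with [refl w] is the adjoint of convolution
    with [w]. *)
Definition refl f : R -> R := fun x => f (- x).

Lemma reflK f : refl (refl f) = f.
Proof. by apply/funext => x; rewrite /refl opprK. Qed.

Lemma bcs_refl f : bcs f -> bcs (refl f).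
Proof.
move=> [mf [M [fM f0]]]; split.
  by apply: measurableT_comp => //; exact: measurable_funN.
exists M; split => x; first exact: fM.
by move=> Mx; apply: f0; rewrite normrN.
Qed.

Lemma bcs0 : bcs (fun=> 0).
Proof. by split => //; exists 0; split => // x; rewrite normr0. Qed.

Lemma bcsD f g : bcs f -> bcs g -> bcs (fun x => f x + g x).
Proof.
move=> [mf [M [fM f0]]] [mg [N [gN g0]]]; split; first exact: measurable_funD.
have M0 : 0 <= M := le_trans (normr_ge0 _) (fM 0).
have N0 : 0 <= N := le_trans (normr_ge0 _) (gN 0).
exists (M + N); split => x.
  by rewrite (le_trans (ler_normD _ _))// lerD.
by move=> h; rewrite f0 ?g0 ?addr0//; lra.
Qed.

Lemma bcsZ c f : bcs f -> bcs (fun x => c * f x).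
Proof.
move=> [mf [M [fM f0]]]; split; first exact: measurable_funM.
have M0 : 0 <= M := le_trans (normr_ge0 _) (fM 0).
have c0 := normr_ge0 c.
exists (`|c| * M + M); split => x.
  by rewrite normrM (le_trans (ler_wpM2l _ (fM x)))// lerDl.
by move=> h; rewrite f0 ?mulr0//; nra.
Qed.

Lemma bcsB f g : bcs f -> bcs g -> bcs (fun x => f x - g x).
Proof.
move=> bf bg; have := bcsD bf (bcsZ (-1) bg).
by congr bcs; apply/funext => x; rewrite mulN1r.
Qed.

Lemma bcsM f g : bcs f -> bcs g -> bcs (fun x => f x * g x).
Proof.
move=> [mf [M [fM f0]]] [mg [N [gN g0]]]; split; first exact: measurable_funM.
have M0 : 0 <= M := le_trans (normr_ge0 _) (fM 0).
have N0 : 0 <= N := le_trans (normr_ge0 _) (gN 0).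
exists (M * N + M); split => x.
  by rewrite normrM (le_trans (ler_pM _ _ (fM x) (gN x)))// lerDl.
by move=> h; rewrite f0 ?mul0r//; nra.
Qed.

Lemma bcs_sum (I : Type) (r : seq I) (F : I -> R -> R) :
  (forall i, bcs (F i)) -> bcs (fun x => \sum_(i <- r) F i x).
Proof.
move=> bF; elim: r => [|i r IH].
  by under eq_fun do rewrite big_nil; exact: bcs0.
by under eq_fun do rewrite big_cons; exact: bcsD.
Qed.

Lemma bcs_comp_reflect f c : bcs f -> bcs (fun x => f (c - x)).
Proof.
move=> [mf [M [fM f0]]]; split.
  by apply: measurableT_comp => //; exact: measurable_reflect.
have M0 : 0 <= M := le_trans (normr_ge0 _) (fM 0).
exists (M + `|c|); split => x; first by rewrite (le_trans (fM _))// lerDl.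
move=> h; apply: f0; have := ler_normB c (c - x).
by rewrite (_ : c - (c - x) = x) ; lra.
Qed.

Lemma integral_bcs f : bcs f -> (\int[mu]_x (f x)%:E = (\int[mu]_x f x)%:E)%E.
Proof. by move=> bf; rewrite fineK//; exact: integrable_fin_num (bcs_integrable bf). Qed.

End bcs.

(** * Convolution *)

Section convolution.
Context {R : realType}.
Local Notation mu := (@lebesgue_measure R).
Implicit Types (f g h w : R -> R).

(** The convolution of [w] and [h], with the junk value 0 where the integral diverges. *)
Definition conv w h : R -> R := fun x => \int[mu]_t (w t * h (x - t)).

Lemma measurable_conv w h : measurable_fun [set: R] w ->
  measurable_fun [set: R] h -> measurable_fun [set: R] (conv w h).
Proof.
move=> mw mh.
pose F (z : measurableTypeR R * measurableTypeR R) : \bar R :=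
  (w z.2 * h (z.1 - z.2))%:E.
have mF : measurable_fun setT F.
  apply/measurable_EFinP; apply: measurable_funM.
    exact: measurableT_comp.
  by apply: measurableT_comp => //; exact: measurable_funB.
apply: measurableT_comp; first exact: fine_measurable.
under eq_fun do rewrite integralE.
apply: emeasurable_funB.
  apply: (eq_measurable_fun (fun x => \int[mu]_y F^\+ (x, y))%E).
    by move=> x _; apply: eq_integral => y _; rewrite !funeposE.
  apply: measurable_fun_fubini_tonelli_F => //; exact: measurable_funepos.
apply: (eq_measurable_fun (fun x => \int[mu]_y F^\- (x, y))%E).
  by move=> x _; apply: eq_integral => y _; rewrite !funenegE.
apply: measurable_fun_fubini_tonelli_F => //; exact: measurable_funeneg.
Qed.

Lemma bcs_conv_integrand w h x : bcs w -> bcs h -> bcs (fun t => w t * h (x - t)).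
Proof. by move=> bw bh; apply: bcsM => //; exact: bcs_comp_reflect. Qed.

Lemma bcs_conv w h : bcs w -> bcs h -> bcs (conv w h).
Proof.
move=> bw bh; have [mw [M [wM w0]]] := bw; have [mh [N [hN h0]]] := bh.
split; first exact: measurable_conv.
have M0 : 0 <= M := le_trans (normr_ge0 _) (wM 0).
have N0 : 0 <= N := le_trans (normr_ge0 _) (hN 0).
have iw := bcs_integrable bw.
have iwn : mu.-integrable setT (EFin \o (fun t => `|w t| * N)).
  by have := integrableZr measurableT N (integrable_norm iw).
pose I := \int[mu]_t (`|w t| * N).
have I0 : 0 <= I by apply: Rintegral_ge0 => t _; rewrite mulr_ge0.
exists (I + M + N); split => x.
  apply: (@le_trans _ _ I); last by rewrite -addrA lerDl addr_ge0.
  have bi := bcs_conv_integrand x bw bh.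
  apply: le_trans (le_normr_Rintegral _ (bcs_integrable bi)) _ => //.
  apply: le_Rintegral => //; first exact: integrable_norm (bcs_integrable bi).
  by move=> t _; rewrite normrM ler_wpM2l.
move=> hx; transitivity (\int[mu]_(t in [set: R]) (0 : R)); last first.
  by rewrite Rintegral_cst// mul0r.
apply: eq_Rintegral => t _; have [tM|Mt] := leP `|t| M; last by rewrite w0 ?mul0r.
rewrite h0 ?mulr0//; have := ler_normB x (x - t).
by have := ler_normD (x - t) t; rewrite subrK; lra.
Qed.

Lemma convC w h : measurable_fun [set: R] w -> measurable_fun [set: R] h ->
  conv w h = conv h w.
Proof.
move=> mw mh; apply/funext => x; rewrite /conv.
rewrite -(Rintegral_reflect x); last first.
  by apply: measurable_funM => //; apply: measurableT_comp => //; exact: measurable_reflect.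
by apply: eq_Rintegral => t _; rewrite subKr mulrC.
Qed.

Lemma refl_conv w h : measurable_fun [set: R] w -> measurable_fun [set: R] h ->
  refl (conv w h) = conv (refl w) (refl h).
Proof.
move=> mw mh; apply/funext => x; rewrite /conv /refl.
rewrite -(Rintegral_reflect 0); last first.
  by apply: measurable_funM => //; apply: measurableT_comp => //; exact: measurable_reflect.
by apply: eq_Rintegral => t _; rewrite sub0r opprB opprK addrC.
Qed.

(** Fubini for a bounded measurable function supported in a square. *)
Lemma Rintegral_swap (F : R -> R -> R) M :
  measurable_fun setT (fun z : measurableTypeR R * measurableTypeR R => F z.1 z.2) ->
  (forall x y, `|F x y| <= M) ->
  (forall x y, M < `|x| -> F x y = 0) -> (forall x y, M < `|y| -> F x y = 0) ->
  \int[mu]_x \int[mu]_y F x y = \int[mu]_y \int[mu]_x F x y.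
Proof.
move=> mF FM F1 F2.
(* The square carrying [F]; its area is finite, so that [F] is integrable on the plane. *)
pose G := EFin \o (fun z : measurableTypeR R * measurableTypeR R => F z.1 z.2).
pose I := `[-M, M]%classic : set (measurableTypeR R).
have mI : measurable I by exact: measurable_itv.
have muI : (mu I < +oo)%E.
  by rewrite /= lebesgue_measure_itv/=; case: ifP; rewrite ?ltry// -EFinB ltry.
have GE : G = G \_ (I `*` I).
  apply/funext => -[x y]; rewrite patchE; case: ifPn => //=.
  rewrite notin_setE/= /I/= !in_itv/= -!ler_norml /G/= => /not_andP[|] /negP; rewrite -ltNge => h.
    by rewrite F1.
  by rewrite F2.
have iG : (mu \x mu)%E.-integrable setT G.
  rewrite GE; apply: (proj1 (@integrable_mkcond _ _ R (mu \x mu)%E (I `*` I) _ _)).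
    exact: measurableX.
  apply: measurable_bounded_integrable => //.
  - exact: measurableX.
  - by rewrite /= product_measure1E// lte_mul_pinfty// ge0_fin_numE.
  - exact: measurable_funTS.
  - exists M; split; first exact: num_real.
    by move=> N MN x _; apply: (le_trans (FM _ _)); exact: ltW.
have b1 x : bcs (F x).
  split; first exact: (measurableT_comp mF (measurable_pair1 x)).
  by exists M; split => [y|y /F2]; [exact: FM|].
have b2 y : bcs (F ^~ y).
  split; first exact: (measurableT_comp mF (measurable_pair2 y)).
  by exists M; split => [x|x /F1]; [exact: FM|].
rewrite /Rintegral.
have -> : (\int[mu]_x (fine (\int[mu]_y (F x y)%:E))%:E = \int[mu]_x \int[mu]_y G (x, y))%E.
  apply: eq_integral => x _; rewrite fineK//.
  exact: integrable_fin_num (bcs_integrable (b1 x)).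
have -> : (\int[mu]_y (fine (\int[mu]_x (F x y)%:E))%:E = \int[mu]_y \int[mu]_x G (x, y))%E.
  apply: eq_integral => y _; rewrite fineK//.
  exact: integrable_fin_num (bcs_integrable (b2 y)).
by rewrite (Fubini iG).
Qed.

Lemma convA f g h : bcs f -> bcs g -> bcs h ->
  conv (conv f g) h = conv f (conv g h).
Proof.
move=> bf bg bh; apply/funext => x; rewrite /conv.
have [mf [A [fA f0]]] := bf; have [mg [B [gB g0]]] := bg.
have [mh [C [hC h0]]] := bh.
have A0 : 0 <= A := le_trans (normr_ge0 _) (fA 0).
have B0 : 0 <= B := le_trans (normr_ge0 _) (gB 0).
have C0 : 0 <= C := le_trans (normr_ge0 _) (hC 0).
have x0 := normr_ge0 x.
transitivity (\int[mu]_t \int[mu]_s (f s * g (t - s) * h (x - t))).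
  apply: eq_Rintegral => t _; rewrite RintegralZr//.
  exact: bcs_integrable (bcs_conv_integrand _ _ _).
(* The bound for the values is added to the one for the support. *)
rewrite (Rintegral_swap (M := A + C + `|x| + A * B * C)).
- apply: eq_Rintegral => s _.
  transitivity (\int[mu]_t (f s * (g (t - s) * h (x - t)))).
    by apply: eq_Rintegral => t _; rewrite mulrA.
  have bgh : bcs (fun t => g (t - s) * h (x - t)).
    apply: bcsM; last exact: bcs_comp_reflect.
    have := bcs_comp_reflect s (bcs_refl bg).
    by congr bcs; apply/funext => t; rewrite /refl opprB.
  rewrite RintegralZl//; last exact: bcs_integrable.
  congr (_ * _).
  rewrite -(Rintegral_reflect x); last exact: bcs_meas.
  rewrite -[RHS](Rintegral_reflect (x - s)); last exact: bcs_meas (bcs_conv_integrand _ _ _).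
  apply: eq_Rintegral => t _; congr (g _ * h _); ring.
- apply: measurable_funM; first apply: measurable_funM.
  + exact: measurableT_comp.
  + by apply: measurableT_comp => //; exact: measurable_funB.
  + by apply: measurableT_comp => //; exact: measurable_funB.
- move=> t s; rewrite !normrM.
  have := ler_pM (mulr_ge0 (normr_ge0 _) (normr_ge0 _)) (normr_ge0 _)
    (ler_pM (normr_ge0 _) (normr_ge0 _) (fA s) (gB (t - s))) (hC (x - t)).
  lra.
- move=> t s ht; rewrite (h0 (x - t)) ?mulr0//.
  have ABC : 0 <= A * B * C by rewrite !mulr_ge0.
  by have := ler_normB x (x - t); rewrite subKr; lra.
- move=> t s hs; rewrite f0 ?mul0r//.
  have ABC : 0 <= A * B * C by rewrite !mulr_ge0.
  lra.
Qed.

Lemma convACA f g h k : bcs f -> bcs g -> bcs h -> bcs k ->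
  conv (conv f g) (conv h k) = conv (conv f h) (conv g k).
Proof.
move=> bf bg bh bk.
have mg := bcs_meas bg; have mh := bcs_meas bh.
rewrite (convA bf bg (bcs_conv bh bk)) -(convA bg bh bk) (convC mg mh).
by rewrite (convA bh bg bk) -(convA bf bh (bcs_conv bg bk)).
Qed.

(** The inner product of [f] and [g] as a convolution. *)
Lemma conv_refl0 f g : conv f (refl g) 0 = \int[mu]_x (f x * g x).
Proof. by apply: eq_Rintegral => t _; rewrite /refl sub0r opprK. Qed.

Lemma convBl f g h : bcs f -> bcs g -> bcs h ->
  conv (fun x => f x - g x) h = (fun x => conv f h x - conv g h x).
Proof.
move=> bf bg bh; apply/funext => x; rewrite /conv -RintegralB//.
- by apply: eq_Rintegral => t _; rewrite mulrBl.
- exact: bcs_integrable (bcs_conv_integrand _ _ _).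
- exact: bcs_integrable (bcs_conv_integrand _ _ _).
Qed.

(** The correlation of [f] and [g] is bounded by the mean of the squares of their L^2 norms:
    the arithmetic-geometric mean inequality under the integral. *)
Lemma norm_conv_refl_le f g x : bcs f -> bcs g ->
  `|conv f (refl g) x| <= (\int[mu]_t (f t ^+ 2) + \int[mu]_t (g t ^+ 2)) / 2.
Proof.
move=> bf bg.
have bfg := bcs_conv_integrand x bf (bcs_refl bg).
have bf2 : bcs (fun t => f t ^+ 2) by under eq_fun do rewrite expr2; exact: bcsM.
have bg2 : bcs (fun t => refl g t ^+ 2).
  by under eq_fun do rewrite expr2; apply: bcsM; exact: bcs_refl.
have bg2s := bcs_comp_reflect x bg2.
have -> : \int[mu]_t (g t ^+ 2) = \int[mu]_t (refl g (x - t) ^+ 2).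
  rewrite (Rintegral_reflect x (f := fun t => refl g t ^+ 2) (bcs_meas bg2)).
  rewrite -(Rintegral_reflect 0 (f := fun t => refl g t ^+ 2) (bcs_meas bg2)).
  by apply: eq_Rintegral => t _; rewrite /refl sub0r opprK.
have /= <- := RintegralD measurableT (bcs_integrable bf2) (bcs_integrable bg2s).
have /= <- := RintegralZr 2^-1 measurableT (bcs_integrable (bcsD bf2 bg2s)).
apply: le_trans (le_normr_Rintegral _ (bcs_integrable bfg)) _ => //.
apply: le_Rintegral => //.
- exact: integrable_norm (bcs_integrable bfg).
- have := bcs_integrable (bcsZ 2^-1 (bcsD bf2 bg2s)).
  by congr (_.-integrable _ _); apply/funext => t /=; rewrite mulrC.
move=> t _; rewrite normrM ler_pdivlMr// -(real_normK (num_real (f t))).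
rewrite -(real_normK (num_real (refl g (x - t)))).
have := sqr_ge0 (`|f t| - `|refl g (x - t)|); nra.
Qed.

End convolution.

(** * Almost orthogonality *)

Section square_function.
Context {R : realType}.
Local Notation mu := (@lebesgue_measure R).
Implicit Types (f g h w c : R -> R).

Lemma Rintegral_bcs_sum K (F : nat -> R -> R) : (forall i, bcs (F i)) ->
  \int[mu]_x (\sum_(i < K) F i x) = \sum_(i < K) \int[mu]_x F i x.
Proof.
move=> bF; elim: K => [|K IH].
  rewrite big_ord0 -[RHS](mul0r (fine (mu [set: R]))) -Rintegral_cst//.
  by apply: eq_Rintegral => x _; rewrite big_ord0.
rewrite big_ord_recr/= -IH.
have bS : bcs (fun x => \sum_(i < K) F i x) by apply: bcs_sum => i; exact: bF.
have /= <- := RintegralD measurableT (bcs_integrable bS) (bcs_integrable (bF K)).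
by apply: eq_Rintegral => x _; rewrite big_ord_recr.
Qed.

(** Almost orthogonality. If the operators [T_j^* T_k], [T_k] being the convolution with
    [phi k], are bounded by [eps j k] at the origin relative to the supremum norm, and the
    symmetric matrix [eps] has row sums at most [B], then the square function of the [T_k] is
    bounded on L^2.
    Convolutions commute, so [<T_j^* T_j f, T_k^* T_k f>] is [T_j^* T_k] applied, at the
    origin, to the correlation of [T_j f] and [T_k f]. *)
Lemma almost_orthogonality K (phi : nat -> R -> R) f (eps : nat -> nat -> R) (B : R) :
  bcs f -> (forall k, bcs (phi k)) -> 0 < B ->
  (forall j k, eps j k = eps k j) ->
  (forall k, (k < K)%N -> \sum_(j < K) eps j k <= B) ->
  (forall j k c (M : R), bcs c -> (forall x, `|c x| <= M) ->
    `|conv (conv (refl (phi j)) (phi k)) c 0| <= eps j k * M) ->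
  \sum_(k < K) \int[mu]_x (conv (phi k) f x ^+ 2) <= B * \int[mu]_x (f x ^+ 2).
Proof.
move=> bf bphi B0 epsC epsB Hphi.
have lin a b d : 0 <= B ^+ 2 * a - 2 * B * b + d -> d <= B * b -> B * b <= B * (B * a).
  by clear; move=> *; lra.
(* [g k] is T_k f, [v k] is T_k^* T_k f, and [G k] is the squared norm of [g k]. *)
pose g k := conv (phi k) f; pose v k := conv (refl (phi k)) (g k).
pose G k := \int[mu]_x (g k x ^+ 2).
have bg k : bcs (g k) by exact: bcs_conv.
have bv k : bcs (v k) by apply: bcs_conv => //; exact: bcs_refl.
have reflv k : refl (v k) = conv (phi k) (refl (g k)).
  rewrite /v refl_conv ?reflK//; [exact: bcs_meas (bcs_refl _)|exact: bcs_meas].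
have fv k : \int[mu]_x (f x * v k x) = G k.
  rewrite -conv_refl0 reflv -(convA bf (bphi k) (bcs_refl (bg k))).
  rewrite (convC (bcs_meas bf) (bcs_meas (bphi k))) conv_refl0.
  by apply: eq_Rintegral => x _; rewrite expr2.
have vv j k : \int[mu]_x (v j x * v k x) <= eps j k * ((G j + G k) / 2).
  rewrite -conv_refl0 reflv /v convACA//; try exact: bcs_refl.
  apply: le_trans (ler_norm _) _; apply: Hphi.
    by apply: bcs_conv => //; exact: bcs_refl.
  by move=> x; exact: norm_conv_refl_le.
pose h x := \sum_(k < K) v k x.
have bh : bcs h by exact: bcs_sum.
set S := \sum_(k < K) _; set F := \int[mu]_x (f x ^+ 2).
have G0 k : 0 <= G k by apply: Rintegral_ge0 => x _; exact: sqr_ge0.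
have fh : \int[mu]_x (f x * h x) = S.
  under eq_Rintegral do rewrite /h mulr_sumr.
  rewrite (@Rintegral_bcs_sum _ (fun k x => f x * v k x)); last by move=> k; exact: bcsM.
  by apply: eq_bigr => k _; exact: fv.
have hh : \int[mu]_x (h x * h x) <= B * S.
  have -> : \int[mu]_x (h x * h x) = \sum_(j < K) \sum_(k < K) \int[mu]_x (v j x * v k x).
    transitivity (\int[mu]_x (\sum_(j < K) v j x * h x)).
      by apply: eq_Rintegral => x _; rewrite -mulr_suml.
    rewrite (@Rintegral_bcs_sum _ (fun k x => v k x * h x)); last by move=> k; exact: bcsM.
    apply: eq_bigr => j _; under eq_Rintegral do rewrite /h mulr_sumr.
    by rewrite (@Rintegral_bcs_sum _ (fun k x => v j x * v k x))// => k; exact: bcsM.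
  have -> : B * S = (\sum_(j < K) B * G j + \sum_(j < K) B * G j) / 2.
    by rewrite -!mulr_sumr -/S; field.
  apply: (@le_trans _ _ ((\sum_(j < K) \sum_(k < K) eps j k * G j +
    \sum_(j < K) \sum_(k < K) eps j k * G k) / 2)).
    rewrite -big_split/= mulr_suml; apply: ler_sum => j _.
    rewrite -big_split/= mulr_suml; apply: ler_sum => k _.
    by rewrite -mulrDr -mulrA; exact: vv.
  rewrite ler_pM2r ?invr_gt0//; apply: lerD.
    apply: ler_sum => j _; rewrite -mulr_suml ler_wpM2r//.
    by under eq_bigr do rewrite epsC; exact: epsB.
  rewrite exchange_big/=; apply: ler_sum => j _; rewrite -mulr_suml ler_wpM2r//.
  exact: epsB.
have bff : bcs (fun x => f x ^+ 2) by under eq_fun do rewrite expr2; exact: bcsM.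
have bfh : bcs (fun x => f x * h x) by exact: bcsM.
have bhh : bcs (fun x => h x * h x) by exact: bcsM.
(* The square of [B f - h] has a nonnegative integral, where [<f, h> = S] and
   [<h, h> <= B S]. *)
have : 0 <= \int[mu]_x ((B * f x - h x) ^+ 2).
  by apply: Rintegral_ge0 => x _; exact: sqr_ge0.
have -> : \int[mu]_x ((B * f x - h x) ^+ 2) =
    B ^+ 2 * F - 2 * B * S + \int[mu]_x (h x * h x).
  have b1 := bcsZ (B ^+ 2) bff; have b2 := bcsZ (2 * B) bfh.
  rewrite /F -fh.
  have /= <- := RintegralZl (B ^+ 2) measurableT (bcs_integrable bff).
  have /= <- := RintegralZl (2 * B) measurableT (bcs_integrable bfh).
  have /= <- := RintegralB measurableT (bcs_integrable b1) (bcs_integrable b2).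
  have /= <- := RintegralD measurableT (bcs_integrable (bcsB b1 b2)) (bcs_integrable bhh).
  by apply: eq_Rintegral => x _; ring.
by move=> /lin /(_ hh); rewrite ler_pM2l.
Qed.

End square_function.

(** * Averaging kernels *)

Section averaging_kernels.
Context {R : realType}.
Local Notation mu := (@lebesgue_measure R).
Implicit Types (f g h w c : R -> R) (r : R).

(** A probability density supported in [[-r, r]]. *)
Definition averaging_kernel r w :=
  [/\ bcs w, forall t, 0 <= w t, \int[mu]_t w t = 1 & forall t, r < `|t| -> w t = 0].

(** Convolution with [w] maps functions bounded by [M] to Lipschitz functions of constant
    [2 M / r]. *)
Definition smoothing r w := forall c (M x y : R), bcs c -> (forall z, `|c z| <= M) ->
  `|conv w c x - conv w c y| <= 2 * M / r * `|x - y|.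

(** The uniform density on [[0, r]] for positive [r], the kernel of the backward average. *)
Definition avg r : R -> R := fun t => r^-1 * \1_(`[0, r]) t.

Lemma bcs_indic_itv (a b : R) : bcs (\1_(`[a, b]%classic) : R -> R).
Proof.
split; first exact: measurable_indic.
exists (Num.max 1 (Num.max `|a| `|b|)); split => x.
  rewrite indicE le_max; case: (_ \in _); rewrite ?normr1 ?lexx// normr0 ler01//.
rewrite !gt_max => /andP[_ /andP[ax bx]]; rewrite indicE memNset//=.
rewrite in_itv/= => /andP[]; move: ax bx.
by case: (ger0P a) => ?; case: (ger0P b) => ?; case: (ger0P x) => ?; lra.
Qed.

Lemma Rintegral_indic_itv (a b : R) : a <= b ->
  \int[mu]_t (\1_(`[a, b]%classic) t : R) = b - a.
Proof.
move=> ab; rewrite /Rintegral integral_indic// setIT /= lebesgue_measure_itv/= lte_fin.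
by have [//|ba|->] := ltgtP a b; [lra|rewrite subrr].
Qed.

Lemma bcs_avg r : bcs (avg r).
Proof. exact/bcsZ/bcs_indic_itv. Qed.

Lemma averaging_kernel_avg r : 0 < r -> averaging_kernel r (avg r).
Proof.
move=> r0; split; first exact: bcs_avg.
- by move=> t; rewrite /avg indicE mulr_ge0 ?ler0n// invr_ge0 ltW.
- rewrite /avg RintegralZl//; last exact: bcs_integrable (bcs_indic_itv _ _).
  by rewrite Rintegral_indic_itv ?ltW// subr0 mulVf// gt_eqF.
- move=> t rt; rewrite /avg indicE memNset ?mulr0//= in_itv/= => /andP[].
  by move: rt; case: (ger0P t); lra.
Qed.

Lemma averaging_kernel_refl r w : averaging_kernel r w -> averaging_kernel r (refl w).
Proof.
move=> [bw w0 w1 wr]; split; first exact: bcs_refl.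
- by move=> t; exact: w0.
- rewrite -w1 -[RHS](Rintegral_reflect 0) ?(bcs_meas bw)//.
    by apply: eq_Rintegral => t _; rewrite sub0r.
  exact: bcs_meas.
- by move=> t rt; apply: wr; rewrite normrN.
Qed.

Lemma averaging_kernelW r r' w : r <= r' -> averaging_kernel r w -> averaging_kernel r' w.
Proof. by move=> rr' [bw w0 w1 wr]; split => // t rt; apply: wr; exact: le_lt_trans rt. Qed.

Lemma norm_conv_averaging_le r w c M x : averaging_kernel r w -> bcs c ->
  (forall z, `|c z| <= M) -> `|conv w c x| <= M.
Proof.
move=> [bw w0 w1 wr] bc cM.
have bi := bcs_integrable (bcs_conv_integrand x bw bc).
apply: le_trans (le_normr_Rintegral _ bi) _ => //.
have -> : M = M * \int[mu]_t w t by rewrite w1 mulr1.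
rewrite -RintegralZl//; last exact: bcs_integrable.
apply: le_Rintegral => //.
- exact: integrable_norm bi.
- exact: bcs_integrable (bcsZ _ bw).
- by move=> t _; rewrite normrM (ger0_norm (w0 t)) mulrC ler_wpM2r.
Qed.

(** Averaging at scale [r] moves a [K]-Lipschitz function by at most [K r]. *)
Lemma norm_conv_averaging_sub_le r w c K x : averaging_kernel r w -> bcs c -> 0 <= K ->
  (forall x y, `|c x - c y| <= K * `|x - y|) -> `|conv w c x - c x| <= K * r.
Proof.
move=> [bw w0 w1 wr] bc K0 cK.
have bp := bcs_conv_integrand x bw bc.
have bs := bcsB bp (bcsZ (c x) bw).
have -> : conv w c x - c x = \int[mu]_t (w t * c (x - t) - c x * w t).
  have /= -> := RintegralB measurableT (bcs_integrable bp) (bcs_integrable (bcsZ (c x) bw)).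
  by rewrite RintegralZl ?w1 ?mulr1//; exact: bcs_integrable.
apply: le_trans (le_normr_Rintegral _ (bcs_integrable bs)) _ => //.
have -> : K * r = K * r * \int[mu]_t w t by rewrite w1 mulr1.
rewrite -RintegralZl//; last exact: bcs_integrable.
apply: le_Rintegral => //.
- exact: integrable_norm (bcs_integrable bs).
- exact: bcs_integrable (bcsZ _ bw).
move=> t _; rewrite (mulrC (c x)) -mulrBr normrM (ger0_norm (w0 t)) mulrC.
have [tr|rt] := leP `|t| r; last by rewrite wr ?mulr0.
rewrite ler_wpM2r// (le_trans (cK _ _))// ler_wpM2l//.
by rewrite (_ : x - t - x = - t) ?normrN//; ring.
Qed.

Lemma smoothing_avg r : 0 < r -> smoothing r (avg r).
Proof.
move=> r0 c M x y bc cM.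
wlog yx : x y / y <= x.
  move=> H; have [/H//|/ltW xy] := leP y x.
  by rewrite distrC (distrC x); exact: H.
have M0 : 0 <= M := le_trans (normr_ge0 _) (cM 0).
have ba := bcs_avg r.
rewrite (convC (bcs_meas ba) (bcs_meas bc)).
have bx := bcs_conv_integrand x bc ba; have by_ := bcs_conv_integrand y bc ba.
rewrite -(RintegralB measurableT (bcs_integrable bx) (bcs_integrable by_)).
apply: le_trans (le_normr_Rintegral _ (bcs_integrable (bcsB bx by_))) _ => //.
have b1 := bcs_indic_itv y x; have b2 := bcs_indic_itv (y - r) (x - r).
have -> : 2 * M / r * `|x - y| =
    M / r * \int[mu]_t ((\1_(`[y, x]%classic) t : R) + \1_(`[y - r, x - r]%classic) t).
  have /= -> := RintegralD measurableT (bcs_integrable b1) (bcs_integrable b2).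
  rewrite !Rintegral_indic_itv//; last lra.
  rewrite ger0_norm ?subr_ge0//; field; exact: lt0r_neq0.
rewrite -RintegralZl//; last exact: bcs_integrable (bcsD b1 b2).
apply: le_Rintegral => //.
- exact: integrable_norm (bcs_integrable (bcsB bx by_)).
- exact: bcs_integrable (bcsZ _ (bcsD b1 b2)).
move=> t _; rewrite -mulrBr normrM -mulrA ler_pM//.
(* The two windows differ only on two intervals of length [x - y]. *)
rewrite /avg -mulrBr normrM (ger0_norm (x := r^-1)) ?invr_ge0 ?(ltW r0)//.
rewrite ler_pM2l ?invr_gt0//.
rewrite !indicE !mem_setE !in_itv/=.
case: (leP 0 (x - t)); case: (leP (x - t) r); case: (leP 0 (y - t)); case: (leP (y - t) r);
 case: (leP y t); case: (leP t x); case: (leP (y - r) t); case: (leP t (x - r)); move=> /= *;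
 rewrite ?subrr ?subr0 ?sub0r ?normrN ?normr0 ?normr1 ?addr0 ?add0r ?ler01 ?lexx//; lra.
Qed.

Lemma smoothing_refl r w : bcs w -> smoothing r w -> smoothing r (refl w).
Proof.
move=> bw sw c M x y bc cM.
have -> : conv (refl w) c = refl (conv w (refl c)).
  by rewrite refl_conv ?reflK//; [exact: bcs_meas|exact: bcs_meas (bcs_refl _)].
have := sw _ M (- x) (- y) (bcs_refl bc) (fun z => cM (- z)).
by rewrite -opprD normrN.
Qed.

End averaging_kernels.

(** * The square function of lacunary averages *)

Section lacunary_square_function.
Context {R : realType}.
Local Notation mu := (@lebesgue_measure R).
Implicit Types (f g h w c : R -> R) (r : R).

Lemma smoothingW r s w : 0 < r -> r <= s -> smoothing s w -> smoothing r w.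
Proof.
move=> r0 rs sw c M x y bc cM; apply: (le_trans (sw c M x y bc cM)).
have M0 : 0 <= M := le_trans (normr_ge0 _) (cM 0).
rewrite ler_wpM2r// ler_wpM2l ?mulr_ge0// lef_pV2// posrE//.
exact: lt_le_trans rs.
Qed.

(** The gain from separated scales: the kernel [a1 - a2] smooths at scale [s], and [b1 - b2] has
    integral zero and lives at scale [r], so their composition is of size [r / s]. *)
Lemma norm_conv_averaging_smoothing_le r s b1 b2 a1 a2 c (M x : R) :
  averaging_kernel r b1 -> averaging_kernel r b2 ->
  bcs a1 -> bcs a2 -> 0 < s -> smoothing s a1 -> smoothing s a2 ->
  bcs c -> (forall z, `|c z| <= M) ->
  `|conv (fun t => b1 t - b2 t) (conv (fun t => a1 t - a2 t) c) x| <= 8 * M * (r / s).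
Proof.
move=> kb1 kb2 ba1 ba2 s0 sa1 sa2 bc cM.
have M0 : 0 <= M := le_trans (normr_ge0 _) (cM 0).
have [[bb1 _ _ _] [bb2 _ _ _]] := (kb1, kb2).
set C := conv (fun t => a1 t - a2 t) c.
have bC : bcs C by apply: bcs_conv => //; exact: bcsB.
(* [C] is Lipschitz, hence almost unchanged by either average. *)
have CK u v : `|C u - C v| <= 4 * M / s * `|u - v|.
  rewrite /C convBl//.
  have := sa1 _ _ u v bc cM; have := sa2 _ _ u v bc cM.
  set X1 := conv a1 c u; set X2 := conv a1 c v; set Y1 := conv a2 c u; set Y2 := conv a2 c v.
  move=> h1 h2; rewrite (_ : X1 - Y1 - (X2 - Y2) = (X1 - X2) - (Y1 - Y2)); last by ring.
  rewrite (le_trans (ler_normB _ _))// (le_trans (lerD h2 h1))// le_eqVlt.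
  by apply/orP; left; apply/eqP; field; exact: lt0r_neq0.
have K0 : 0 <= 4 * M / s by rewrite divr_ge0 ?mulr_ge0// ltW.
have h1 := norm_conv_averaging_sub_le x kb1 bC K0 CK.
have h2 := norm_conv_averaging_sub_le x kb2 bC K0 CK.
rewrite convBl// (_ : conv b1 C x - conv b2 C x =
  (conv b1 C x - C x) - (conv b2 C x - C x)); last by ring.
rewrite (le_trans (ler_normB _ _))// (le_trans (lerD h1 h2))// le_eqVlt.
by apply/orP; left; apply/eqP; field; exact: lt0r_neq0.
Qed.

Lemma sum_geometric_le (q : R) m : 0 <= q < 1 -> \sum_(i < m) q ^+ i <= (1 - q)^-1.
Proof.
move=> /andP[q0 q1]; rewrite -div1r ler_pdivlMr ?subr_gt0//.
suff -> : (\sum_(i < m) q ^+ i) * (1 - q) = 1 - q ^+ m.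
  by rewrite lerBlDr lerDl exprn_ge0.
elim: m => [|m IH]; first by rewrite big_ord0 mul0r expr0 subrr.
by rewrite big_ord_recr/= mulrDl IH exprSr; ring.
Qed.

Lemma sum_geometric_dist_le (q : R) K k : 0 <= q < 1 -> (k < K)%N ->
  \sum_(j < K) q ^+ ((j - k) + (k - j)) <= 2 / (1 - q).
Proof.
move=> q01 kK; rewrite -(subnKC (ltnW kK)); set m := (K - k)%N.
rewrite big_split_ord/= (_ : 2 = 1 + 1)// mulrDl mul1r; apply: lerD.
  (* The indices [j < k], read backwards, carry the exponents 1, ..., k. *)
  rewrite (reindex_inj rev_ord_inj)/=.
  apply: le_trans (sum_geometric_le k.+1 q01).
  rewrite big_ord_recl/= -[leLHS]add0r; apply: lerD => //.
  apply: ler_sum => i _; rewrite (_ : ((k - i.+1) - k + (k - (k - i.+1)))%N = i.+1)//.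
  by rewrite subKn ?ltn_ord// (_ : (k - i.+1 - k = 0)%N)//; apply/eqP; rewrite subn_eq0 leq_subr.
apply: le_trans (sum_geometric_le m q01).
apply: ler_sum => i _; rewrite addKn (_ : (k - (k + i) = 0)%N) ?addn0//.
by apply/eqP; rewrite subn_eq0 leq_addr.
Qed.

(** The kernel of the difference of the averages at the scales [n k.+1] and [n k]. *)
Definition diff_kernel (n : R^nat) k : R -> R := fun t => avg (n k.+1) t - avg (n k) t.

Lemma bcs_diff_kernel n k : bcs (diff_kernel n k).
Proof. by apply: bcsB; exact: bcs_avg. Qed.

Lemma lacunary_ratio (n : R^nat) : lacunary n -> exists2 q : R, 0 < q < 1 &
  forall j k, (j <= k)%N -> n j <= q ^+ (k - j) * n k.
Proof.
move=> ln; have n0 k := lacunary_gt0 k ln; have [_ [b b1 nb]] := ln.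
have b0 : 0 < b by exact: lt_trans b1.
exists b^-1; first by rewrite invr_gt0 b0 invf_lt1.
move=> j k jk; rewrite -(subnKC jk) addKn; elim: (k - j)%N => [|m IH].
  by rewrite addn0 expr0 mul1r.
apply: le_trans IH _; rewrite exprSr -mulrA addnS ler_wpM2l ?exprn_ge0 ?invr_ge0 ?(ltW b0)//.
by rewrite ler_pdivlMl// -ler_pdivlMr.
Qed.

(** The square function of a lacunary sequence of averages is bounded on L^2. *)
Lemma lacunary_square_function_bound (n : R^nat) : lacunary n ->
  exists2 B : R, 0 < B & forall f K, bcs f ->
    \sum_(k < K) \int[mu]_x (conv (diff_kernel n k) f x ^+ 2) <= B * \int[mu]_x (f x ^+ 2).
Proof.
move=> ln; have n0 k := lacunary_gt0 k ln.
have [q /andP[q0 q1] nq] := lacunary_ratio ln.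
have qr : 0 <= q < 1 by rewrite (ltW q0).
have nS k : n k <= n k.+1 by case: ln => /increasing_seqP h _; exact/ltW.
(* [8 / q] comes from two scales [j < k]: the coarser kernel smooths at scale [n k], the finer
   one lives at scale [n j.+1], and [n j.+1 / n k <= q ^+ (k - j) / q]. *)
exists (8 / q * (2 / (1 - q))).
  by rewrite !mulr_gt0 ?invr_gt0 ?subr_gt0.
move=> f K bf.
have bd k := bcs_diff_kernel n k.
apply: (almost_orthogonality (eps := fun j k => 8 / q * q ^+ ((j - k) + (k - j)))) => //.
- by rewrite !mulr_gt0 ?invr_gt0 ?subr_gt0.
- by move=> j k; rewrite addnC.
- move=> k kK; rewrite -mulr_sumr ler_pM2l ?mulr_gt0 ?invr_gt0//.
  exact: sum_geometric_dist_le.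
move=> j k c M bc cM.
have M0 : 0 <= M := le_trans (normr_ge0 _) (cM 0).
have kA i : averaging_kernel (n i.+1) (avg (n i.+1)) by exact: averaging_kernel_avg.
have kA' i : averaging_kernel (n i.+1) (avg (n i)).
  by apply: averaging_kernelW (nS i) _; exact: averaging_kernel_avg.
have sA i : smoothing (n i) (avg (n i)) by exact: smoothing_avg.
have sA' i : smoothing (n i) (avg (n i.+1)) by exact: smoothingW (nS i) _.
have bA i := bcs_avg (n i).
have nlt i l : (i < l)%N -> n i.+1 / n l <= q^-1 * q ^+ (l - i).
  move=> il; rewrite ler_pdivrMr// (le_trans (nq _ _ il))//.
  by rewrite -(subnSK il) exprS mulKf ?gt_eqF.
have [jk|kj|->] := ltngtP j k.
- rewrite convA//; last exact: bcs_refl.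
  apply: le_trans (norm_conv_averaging_smoothing_le 0
    (averaging_kernel_refl (kA j)) (averaging_kernel_refl (kA' j)) (bA _) (bA _) (n0 k)
    (sA' k) (sA k) bc cM) _.
  rewrite (_ : (j - k = 0)%N) ?add0n; last by apply/eqP; rewrite subn_eq0 ltnW.
  rewrite [leRHS](_ : _ = 8 * M * (q^-1 * q ^+ (k - j))); last by ring.
  by rewrite ler_wpM2l ?mulr_ge0 ?nlt.
- rewrite (convC (bcs_meas (bcs_refl (bd j))) (bcs_meas (bd k))) convA//; last exact: bcs_refl.
  apply: le_trans (norm_conv_averaging_smoothing_le 0 (kA k) (kA' k)
    (bcs_refl (bA _)) (bcs_refl (bA _)) (n0 j)
    (smoothing_refl (bA _) (sA' j)) (smoothing_refl (bA _) (sA j)) bc cM) _.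
  rewrite (_ : (k - j = 0)%N) ?addn0; last by apply/eqP; rewrite subn_eq0 ltnW.
  rewrite [leRHS](_ : _ = 8 * M * (q^-1 * q ^+ (j - k))); last by ring.
  by rewrite ler_wpM2l ?mulr_ge0 ?nlt.
(* On the diagonal there is no gain and none is needed. *)
- rewrite subnn addn0 expr0 mulr1 convA//; last exact: bcs_refl.
  have key r w1 w2 (d : R -> R) (D : R) y : averaging_kernel r w1 -> averaging_kernel r w2 ->
      bcs d -> (forall z, `|d z| <= D) -> `|conv (fun t => w1 t - w2 t) d y| <= 2 * D.
    move=> k1 k2 bd' dD; have [[bw1 _ _ _] [bw2 _ _ _]] := (k1, k2).
    rewrite convBl// (le_trans (ler_normB _ _))//.
    have := norm_conv_averaging_le y k1 bd' dD; have := norm_conv_averaging_le y k2 bd' dD.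
    lra.
  apply: (@le_trans _ _ (2 * (2 * M))).
    apply: (key _ _ _ _ _ _ (averaging_kernel_refl (kA k)) (averaging_kernel_refl (kA' k))).
      exact: bcs_conv.
    by move=> z; exact: (key _ _ _ _ _ _ (kA k) (kA' k)).
  rewrite mulrA ler_wpM2r// ler_pdivlMr//; lra.
Qed.

End lacunary_square_function.

(** * Norms of sequences *)

Section sequence_norms.
Context {R : realType}.
Implicit Types (d : nat -> R).

(** The norm of [d] in the sequence space l^s, [s >= 1], possibly infinite. *)
Definition lnorm (s : R) d : \bar R := ((\sum_(k <oo) (`|d k| `^ s)%:E) `^ s^-1)%E.

Lemma nneseries_le (u : nat -> \bar R) (M : \bar R) : (forall k, 0 <= u k)%E ->
  (forall K, \sum_(k < K) u k <= M)%E -> (\sum_(k <oo) u k <= M)%E.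
Proof.
move=> u0 uM; apply: lime_le; first by apply: is_cvg_nneseries => k _ _.
by apply: nearW => K; rewrite big_mkord.
Qed.

Lemma lnorm_le s d (W : R) : 0 < s -> 0 <= W ->
  (forall K, \sum_(k < K) `|d k| `^ s <= W `^ s) -> (lnorm s d <= W%:E)%E.
Proof.
move=> s0 W0 dW.
rewrite -[W%:E]poweRe1 ?lee_fin// -(mulfV (lt0r_neq0 s0)) poweRrM.
apply: gt0_ler_poweR.
- by rewrite invr_ge0 ltW.
- by rewrite in_itv/= leey andbT; apply: nneseries_ge0 => k _ _; rewrite lee_fin powR_ge0.
- by rewrite in_itv/= leey andbT lee_fin powR_ge0.
apply: nneseries_le => [k|K]; first by rewrite lee_fin powR_ge0.
by rewrite sumEFin poweR_EFin lee_fin.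
Qed.

Lemma lnorm_nonincreasing p s d : 0 < p -> p <= s -> (lnorm s d <= lnorm p d)%E.
Proof.
move=> p0 ps; have s0 : 0 < s by exact: lt_le_trans ps.
have [->|] := eqVneq (lnorm p d) +oo%E; first exact: leey.
rewrite -ltey => Npfin.
have Np0 : (0 <= lnorm p d)%E by exact: poweR_ge0.
set S := (\sum_(k <oo) (`|d k| `^ p)%:E)%E.
have S0 : (0 <= S)%E by apply: nneseries_ge0 => k _ _; rewrite lee_fin powR_ge0.
have SN : (S = (fine (lnorm p d) `^ p)%:E)%E.
  rewrite -poweR_EFin fineK ?ge0_fin_numE// /lnorm -poweRrM mulVf ?poweRe1//.
  exact: lt0r_neq0.
rewrite -[leRHS]fineK ?ge0_fin_numE//.
have N0 : 0 <= fine (lnorm p d) by rewrite fine_ge0.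
move: (fine _) N0 SN => N N0 SN.
have sumN K : \sum_(k < K) `|d k| `^ p <= N `^ p.
  rewrite -lee_fin -SN -sumEFin -(big_mkord xpredT (fun k => (`|d k| `^ p)%:E)).
  by apply: nneseries_lim_ge => k _ _; rewrite lee_fin powR_ge0.
have dN k : `|d k| <= N.
  rewrite leNgt; apply/negP => Nd.
  have := sumN k.+1; rewrite big_ord_recr/= leNgt => /negP; apply.
  apply: (@lt_le_trans _ _ (`|d k| `^ p)); first by rewrite gt0_ltr_powR.
  by rewrite lerDr sumr_ge0// => i _; rewrite powR_ge0.
apply: lnorm_le => // K.
have [N1|N1] := eqVneq N 0; last first.
  apply: (@le_trans _ _ (\sum_(k < K) `|d k| `^ p * N `^ (s - p))).
    apply: ler_sum => k _; have [->|dk0] := eqVneq `|d k| 0.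
      by rewrite powR0 ?mulr_ge0 ?powR_ge0 ?gt_eqF.
    rewrite -{1}(subrKC p s) powRD; last by rewrite dk0 implybT.
    rewrite ler_wpM2l ?powR_ge0// ge0_ler_powR ?subr_ge0 ?nnegrE//.
  rewrite -mulr_suml [leRHS](_ : _ = N `^ p * N `^ (s - p)); last first.
    by rewrite -powRD ?subrKC// N1 implybT.
  by rewrite ler_wpM2r ?powR_ge0.
rewrite N1 powR0 ?gt_eqF// big1// => k _.
by rewrite (_ : `|d k| = 0) ?powR0 ?gt_eqF//; apply/eqP; rewrite eq_le normr_ge0 -{1}N1 dN.
Qed.


Lemma poweR_half_le (L : R) (S : \bar R) : 0 < L -> (0 <= S)%E ->
  (S `^ 2^-1 <= (L^-1)%:E + L%:E * S)%E.
Proof.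
move=> L0; case: S => [x| |]//; last first.
  by move=> _; rewrite gt0_muley ?lte_fin// addey// leey.
rewrite lee_fin => x0; rewrite poweR_EFin powR12_sqrt//= lee_fin.
have [y0 yx] := (sqrtr_ge0 x, sqr_sqrtr x0).
rewrite -{2}yx; move: (Num.sqrt x) y0 => y y0.
rewrite -(ler_pM2l L0) mulrDr divff ?lt0r_neq0//.
have := sqr_ge0 (L * y - 1); nra.
Qed.

End sequence_norms.

(** * Backward averages and variation *)

Section backward_averages.
Context {R : realType}.
Local Notation mu := (@lebesgue_measure R).
Implicit Types (f g a : R -> R) (r s : R) (n : R^nat).

(** The sequence of consecutive differences of averages at [x]; its l^s norm is the variation. *)
Definition avg_diff n f x : nat -> R :=
  fun k => backward_average (n k.+1) f x - backward_average (n k) f x.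

Lemma variation_operatorE s n f x : variation_operator s n f x = lnorm s (avg_diff n f x).
Proof.
pose u k := (`|backward_average (n k) f x - backward_average (n k.-1) f x| `^ s)%:E.
have uE : (\sum_(1 <= k <oo) u k = \sum_(k <oo) (`|avg_diff n f x k| `^ s)%:E)%E.
  transitivity (\sum_(k <oo) u (k + 1)%N)%E.
    by apply/esym/nneseries_addn => k; rewrite lee_fin powR_ge0.
  by apply: eq_eseriesr => k _; rewrite addn1.
by rewrite /lnorm -uE.
Qed.

Lemma measurable_indic_itv (p q : R) : measurable_fun [set: R] (\1_(`[p, q]%classic) : R -> R).
Proof. exact: measurable_indic. Qed.

(** Averages of a merely measurable function, the indicator being the second factor. *)
Lemma backward_average_conv r f : measurable_fun [set: R] f ->
  backward_average r f = fun x => r^-1 * conv f (\1_(`[0, r]%classic)) x.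
Proof.
move=> mf; apply/funext => x; congr (_ * _).
rewrite (convC mf (measurable_indic_itv 0 r)) Rintegral_mkcond.
apply: eq_Rintegral => t _; rewrite patchE indicE.
by case: ifPn; rewrite ?mul1r ?mul0r.
Qed.

Lemma backward_average_avg r f : bcs f -> backward_average r f = conv (avg r) f.
Proof.
move=> bf; rewrite backward_average_conv; last exact: bcs_meas.
have bi := bcs_indic_itv 0 r.
apply/funext => x; rewrite (convC (bcs_meas bf) (bcs_meas bi)) /conv -RintegralZl//; last first.
  exact: bcs_integrable (bcs_conv_integrand _ _ _).
by apply: eq_Rintegral => t _; rewrite mulrA.
Qed.

Lemma measurable_backward_average r f : measurable_fun [set: R] f ->
  measurable_fun [set: R] (backward_average r f).
Proof.
move=> mf; rewrite backward_average_conv//; apply: measurable_funM => //.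
by apply: measurable_conv => //; exact: measurable_indic_itv.
Qed.

Lemma measurable_variation_operator s n f : measurable_fun [set: R] f ->
  measurable_fun [set: R] (variation_operator s n f).
Proof.
move=> mf; rewrite (_ : variation_operator s n f = lnorm s \o avg_diff n f); last first.
  by apply/funext => x; exact: variation_operatorE.
apply: (@measurableT_comp _ _ _ _ _ _ (fun z => poweR z s^-1) _
  (fun x => \sum_(0 <= k <oo) (`|avg_diff n f x k| `^ s)%:E)%E).
  exact: measurable_poweR.
apply: ge0_emeasurable_sum => [k x _ _|k _]; first by rewrite lee_fin powR_ge0.
apply/measurable_EFinP; apply: (measurableT_comp (measurable_powR _)).
apply: measurableT_comp => //; by apply: measurable_funB; exact: measurable_backward_average.
Qed.

Lemma ae_eq_backward_average r f g : measurable_fun [set: R] f ->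
  measurable_fun [set: R] g -> ae_eq mu setT f g ->
  backward_average r f = backward_average r g.
Proof.
move=> mf mg fg; rewrite !backward_average_conv//; apply/funext => x.
congr (_ * fine _); apply: ae_eq_integral => //.
- apply/measurable_EFinP; apply: measurable_funM => //; apply: measurableT_comp.
    exact: measurable_indic_itv.
  exact: measurable_reflect.
- apply/measurable_EFinP; apply: measurable_funM => //; apply: measurableT_comp.
    exact: measurable_indic_itv.
  exact: measurable_reflect.
by apply: filterS fg => t h _; rewrite h.
Qed.

Lemma integrable_measurable f : mu.-integrable setT (EFin \o f) -> measurable_fun [set: R] f.
Proof. by move=> fi; apply/measurable_EFinP; exact: measurable_int fi. Qed.

Lemma integrable_conv_indic f (p q x : R) : mu.-integrable setT (EFin \o f) ->
  mu.-integrable setT (EFin \o (fun t => f t * (\1_(`[p, q]%classic) (x - t)))).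
Proof.
move=> fi; have mf := integrable_measurable fi.
apply: le_integrable fi => //.
  apply/measurable_EFinP; apply: measurable_funM => //; apply: measurableT_comp.
    exact: measurable_indic_itv.
  exact: measurable_reflect.
move=> t _ /=; rewrite lee_fin normrM ler_piMr// indicE.
by case: (_ \in _); rewrite ?normr1 ?normr0.
Qed.

Lemma norm_backward_average_le r f x : 0 < r -> mu.-integrable setT (EFin \o f) ->
  `|backward_average r f x| <= r^-1 * \int[mu]_t `|f t|.
Proof.
move=> r0 fi; have mf := integrable_measurable fi.
rewrite backward_average_conv// normrM ger0_norm ?invr_ge0 ?(ltW r0)// ler_pM2l ?invr_gt0//.
have ci := integrable_conv_indic 0 r x fi.
apply: le_trans (le_normr_Rintegral _ ci) _ => //.
apply: le_Rintegral => //; [exact: integrable_norm ci|exact: integrable_norm fi|].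
move=> t _; rewrite normrM ler_piMr// indicE.
by case: (_ \in _); rewrite ?normr1 ?normr0.
Qed.

End backward_averages.

(** * Variation of atoms *)

Section atoms.
Context {R : realType}.
Local Notation mu := (@lebesgue_measure R).
Implicit Types (f g a : R -> R) (r s u v : R) (n : R^nat).

(** An atom on [[u, v]] whose bound holds everywhere and not only almost everywhere. *)
Definition bounded_atom u v a := [/\ measurable_fun [set: R] a,
  forall x, x \notin `[u, v] -> a x = 0, forall x, `|a x| <= (v - u)^-1 &
  \int[mu]_x a x = 0].

Lemma bcs_bounded_atom u v a : bounded_atom u v a -> bcs a.
Proof.
move=> [ma a0 aL _]; split => //.
exists (Num.max (v - u)^-1 (Num.max `|u| `|v|)); split => x.
  by rewrite le_max aL.
rewrite !gt_max => /andP[_ /andP[ux vx]]; apply: a0.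
rewrite in_itv/=; apply/negP => /andP[]; move: ux vx.
by case: (ger0P u) => ?; case: (ger0P v) => ?; case: (ger0P x) => ?; lra.
Qed.

Lemma lebesgue_measure_setT_gt0 : (0 < mu [set: R])%E.
Proof.
apply: (@lt_le_trans _ _ (mu `[0, 1]%classic)).
  by rewrite lebesgue_measure_itv/= lte_fin ltr01 -EFinB lte_fin subr0.
by apply: le_measure; rewrite ?inE//; exact: measurable_itv.
Qed.

(** An atom agrees almost everywhere with one bounded everywhere, obtained by replacing the
    excessive values by 0; averages do not see the difference. *)
Lemma H1_atom_bounded a : H1_atom a -> exists u v b, [/\ u < v, bounded_atom u v b &
  forall r, backward_average r a = backward_average r b].
Proof.
move=> [ma [u [v [uv a0 aN aI]]]].
exists u, v; pose L := (v - u)^-1.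
pose b x := if `|a x| <= L then a x else 0.
have mb : measurable_fun [set: R] b.
  apply: measurable_fun_ifT => //.
  by apply: measurable_fun_ler => //; exact: measurableT_comp.
have ab : ae_eq mu setT a b.
  move: aN; rewrite unlock lebesgue_measure_setT_gt0 => /ess_supP.
  by apply: filterS => x /=; rewrite lee_fin /b => ->.
exists b; split => //; last by move=> r; exact: ae_eq_backward_average.
have L0 : 0 <= L by rewrite invr_ge0 subr_ge0 ltW.
split => //.
- by move=> x xuv; rewrite /b a0//; case: ifP.
- by move=> x; rewrite /b; case: ifPn => //; rewrite normr0.
- rewrite -aI; congr fine; apply: ae_eq_integral => //; [exact/measurable_EFinP..|].
  by apply: filterS ab => x h _; rewrite h.
Qed.

Section bounded_atom.
Variables (u v : R) (a : R -> R).
Hypotheses (uv : u < v) (atom : bounded_atom u v a).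
Let L := v - u.

Let L0 : 0 < L. Proof. by rewrite subr_gt0. Qed.
Let ba : bcs a. Proof. exact: bcs_bounded_atom atom. Qed.
Let ma : measurable_fun [set: R] a. Proof. by case: atom. Qed.

Lemma atom_abs_le x : `|a x| <= L^-1 * \1_(`[u, v]%classic) x.
Proof.
have [_ a0 aL _] := atom; rewrite indicE mem_setE.
by case: (boolP (x \in `[u, v])) => [_|/a0 ->]; rewrite ?mulr1// normr0 mulr0.
Qed.

Lemma Rintegral_atom_abs : \int[mu]_t `|a t| <= 1.
Proof.
rewrite (_ : 1 = L^-1 * \int[mu]_t (\1_(`[u, v]%classic) t : R)); last first.
  by rewrite Rintegral_indic_itv ?(ltW uv)// mulVf// lt0r_neq0.
rewrite -RintegralZl//; last exact: bcs_integrable (bcs_indic_itv _ _).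
apply: le_Rintegral => //; first exact: integrable_norm (bcs_integrable ba).
  exact: bcs_integrable (bcsZ _ (bcs_indic_itv _ _)).
by move=> x _; exact: atom_abs_le.
Qed.

Lemma Rintegral_atom_sqr : \int[mu]_t (a t ^+ 2) <= L^-1.
Proof.
have ba2 : bcs (fun t => a t ^+ 2) by under eq_fun do rewrite expr2; exact: bcsM.
apply: (@le_trans _ _ (L^-1 * \int[mu]_t `|a t|)); last first.
  by rewrite ler_piMr ?invr_ge0 ?(ltW L0)//; exact: Rintegral_atom_abs.
have ia := integrable_norm (bcs_integrable ba).
have := integrableZl measurableT L^-1 ia => iZ.
rewrite -RintegralZl//.
apply: le_Rintegral => //; first exact: bcs_integrable.
move=> x _; rewrite -[leLHS]ger0_norm ?sqr_ge0// normrX expr2 ler_wpM2r//.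
by case: atom.
Qed.

Lemma backward_average_atom_lt r x : x < u -> backward_average r a x = 0.
Proof.
move=> xu; rewrite backward_average_conv// /conv.
rewrite (_ : \int[mu]_t _ = 0) ?mulr0//.
transitivity (\int[mu]_(t in [set: R]) (0 : R)); last by rewrite Rintegral_cst// mul0r.
apply: eq_Rintegral => t _; have [_ a0 _ _] := atom.
case: (boolP (t \in `[u, v])) => [|/a0 ->]; last by rewrite mul0r.
rewrite in_itv/= => /andP[ut _]; rewrite indicE memNset ?mulr0//=.
by rewrite in_itv/= => /andP[]; lra.
Qed.

(** A bound for the average at scale [r] of an atom on [[u, v]], far to the right of [v]. *)
Definition atom_tail r x := (L < r)%R%:R * (r^-1 * \1_(`[u + r, v + r]%classic) x).

Lemma atom_tail_ge0 r x : 0 < r -> 0 <= atom_tail r x.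
Proof.
by move=> r0; rewrite !mulr_ge0 ?ler0n ?invr_ge0 ?(ltW r0)// indicE ler0n.
Qed.

Lemma bcs_atom_tail r : bcs (atom_tail r).
Proof. exact/bcsZ/bcsZ/bcs_indic_itv. Qed.

Lemma Rintegral_atom_tail r : \int[mu]_x atom_tail r x = (L < r)%R%:R * (r^-1 * L).
Proof.
have bi := bcs_indic_itv (u + r) (v + r).
rewrite RintegralZl//; last exact: bcs_integrable (bcsZ _ bi).
rewrite RintegralZl//; last exact: bcs_integrable bi.
by rewrite Rintegral_indic_itv ?lerD2r ?(ltW uv)// (_ : v + r - (u + r) = L)// /L; ring.
Qed.

(** To the right of its support the averages of an atom vanish, because it has mean zero,
    unless the averaging window starts inside the support; far to the right this requires a
    scale [r] larger than [v - u]. *)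
Lemma norm_backward_average_atom_le r x : 0 < r -> v + L < x ->
  `|backward_average r a x| <= atom_tail r x.
Proof.
move=> r0 vx; have [_ a0 _ aI] := atom.
case: (boolP (x \in `[u + r, v + r])) => xr.
  rewrite /atom_tail indicE mem_setE xr.
  have -> : L < r by move: xr; rewrite in_itv/= => /andP[_]; move: vx; lra.
  rewrite mul1r (le_trans (norm_backward_average_le x r0 (bcs_integrable ba)))//.
  by rewrite ler_wpM2l ?invr_ge0 ?(ltW r0)//; exact: Rintegral_atom_abs.
rewrite (_ : backward_average r a x = 0) ?normr0 ?atom_tail_ge0//.
rewrite backward_average_conv// (_ : conv _ _ _ = 0) ?mulr0// /conv.
have vx' : v < x by apply: lt_trans vx; rewrite ltrDl.
have [xur|urx] := ltP x (u + r).
  rewrite -aI; apply: eq_Rintegral => t _.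
  case: (boolP (t \in `[u, v])) => [|/a0 ->]; last by rewrite mul0r.
  rewrite in_itv/= => /andP[ut tv]; rewrite indicE mem_set ?mulr1//=.
  by rewrite in_itv/=; apply/andP; split; move: ut tv xur vx'; lra.
transitivity (\int[mu]_(t in [set: R]) (0 : R)); last by rewrite Rintegral_cst// mul0r.
apply: eq_Rintegral => t _.
case: (boolP (t \in `[u, v])) => [|/a0 ->]; last by rewrite mul0r.
rewrite in_itv/= => /andP[ut tv]; rewrite indicE memNset ?mulr0//=.
have vrx : v + r < x by move: xr; rewrite in_itv/= urx/= -ltNge.
by rewrite in_itv/= => /andP[_]; move: tv vrx; lra.
Qed.

Section lacunary_atom.
Variables (n : R^nat) (s : R).
Hypotheses (ln : lacunary n) (s2 : 2 <= s).
Let n0 k : 0 < n k. Proof. exact: lacunary_gt0. Qed.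

(** The [k]-th term of a series that, together with a multiple of an indicator, dominates the
    variation of the atom: a square for the points near the support, tails for the others. *)
Definition atom_majorant k x :=
  L * avg_diff n a x k ^+ 2 + (atom_tail (n k.+1) x + atom_tail (n k) x).

Lemma atom_majorant_ge0 k x : 0 <= atom_majorant k x.
Proof.
apply: addr_ge0; first by apply: mulr_ge0; [exact: (ltW L0)|exact: sqr_ge0].
by apply: addr_ge0; exact: atom_tail_ge0.
Qed.

Lemma variation_atom_le x : (variation_operator s n a x <=
  (L^-1 * \1_(`[u, v + L]%classic) x)%:E + \sum_(k <oo) (atom_majorant k x)%:E)%E.
Proof.
rewrite variation_operatorE.
have M0 : (0 <= \sum_(k <oo) (atom_majorant k x)%:E)%E.
  by apply: nneseries_ge0 => k _ _; rewrite lee_fin atom_majorant_ge0.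
have s0 : 0 < s by apply: lt_le_trans s2.
(* Left of the support all averages vanish. *)
have [xu|ux] := ltP x u.
  have : (lnorm s (avg_diff n a x) <= 0%:E)%E.
    apply: lnorm_le => // K; rewrite powR0 ?gt_eqF// big1// => k _.
    by rewrite /avg_diff !backward_average_atom_lt// subrr normr0 powR0// gt_eqF.
  move/le_trans; apply; rewrite adde_ge0// lee_fin mulr_ge0 ?invr_ge0 ?(ltW L0)//.
(* Near the support the l^s norm is at most the l^2 norm, which is linearized. *)
have [xv|vx] := leP x (v + L).
  rewrite indicE mem_set ?mulr1; last by rewrite /= in_itv/= ux.
  apply: le_trans (lnorm_nonincreasing _ _ s2) _ => //.
  apply: le_trans (poweR_half_le L0 _) _.
    by apply: nneseries_ge0 => k _ _; rewrite lee_fin powR_ge0.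
  rewrite leeD2l// -nneseriesZl; last by move=> k _; rewrite lee_fin powR_ge0.
  apply: lee_nneseries => [k _ _|k _].
    by rewrite -EFinM lee_fin mulr_ge0 ?powR_ge0// ltW.
  rewrite -EFinM lee_fin powR_mulrn// real_normK ?num_real// lerDl.
  by apply: addr_ge0; exact: atom_tail_ge0.
(* Far from the support the l^s norm is at most the l^1 norm. *)
apply: le_trans (lnorm_nonincreasing _ ltr01 _) _.
  by rewrite (le_trans _ s2)// ler1n.
rewrite /lnorm invr1 poweRe1; last first.
  by apply: nneseries_ge0 => k _ _; rewrite lee_fin powR_ge0.
rewrite -[leLHS]add0e; apply: leeD.
  by rewrite lee_fin mulr_ge0 ?invr_ge0 ?(ltW L0)// indicE ler0n.
apply: lee_nneseries => [k _ _|k _]; first by rewrite lee_fin powR_ge0.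
rewrite lee_fin powRr1// /avg_diff (le_trans (ler_normB _ _))//.
rewrite -[leLHS]add0r; apply: lerD; first by rewrite mulr_ge0 ?sqr_ge0// ltW.
by apply: lerD; exact: norm_backward_average_atom_le.
Qed.

End lacunary_atom.

End bounded_atom.

(** The geometric sum of [L / n k] over the scales [n k] above [L]. *)
Lemma lacunary_sum_inv_le n (q L : R) K : 0 < q < 1 -> 0 < L -> (forall k, 0 < n k) ->
  (forall k, n k <= q * n k.+1) ->
  \sum_(k < K) (L < n k)%R%:R * ((n k)^-1 * L) <= (1 - q)^-1.
Proof.
move=> /andP[q0 q1] L0 n0 nq.
(* Up to the factor [1 - q] each term is a difference of the bounded monotone sequence [m]. *)
pose m k := Num.min 1 ((n k)^-1 * L).
have step k : (1 - q) * ((L < n k)%R%:R * ((n k)^-1 * L)) <= m k - m k.+1.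
  have h : (n k.+1)^-1 * L <= q * ((n k)^-1 * L).
    by rewrite mulrA ler_pM2r// ler_pdivlMr// mulrC ler_pdivrMr.
  have h0 : 0 < (n k)^-1 * L by rewrite mulr_gt0 ?invr_gt0.
  have -> : (L < n k) = ((n k)^-1 * L < 1) by rewrite mulrC ltr_pdivrMr// mul1r.
  rewrite /m; move: ((n k)^-1 * L) ((n k.+1)^-1 * L) h h0 => z y h h0.
  case: (ltP z 1) => z1 /=.
    rewrite mul1r.
    have : Num.min 1 y <= y by rewrite ge_min lexx orbT.
    lra.
  by rewrite mul0r mulr0 subr_ge0 ge_min lexx.
rewrite -div1r ler_pdivlMr ?subr_gt0// mulrC mulr_sumr.
apply: (@le_trans _ _ (m 0%N - m K)).
  elim: K => [|K IH]; first by rewrite big_ord0 subrr.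
  rewrite big_ord_recr/= [leRHS](_ : _ = (m 0%N - m K) + (m K - m K.+1)).
    exact: lerD.
  by rewrite subrKA.
have : m 0%N <= 1 by rewrite ge_min lexx.
have : 0 <= m K by rewrite le_min ler01 mulr_ge0// ?invr_ge0 ltW.
lra.
Qed.

(** The variation of atoms is bounded in L^1, uniformly in the atom. *)
Lemma integral_variation_atom_le (n : R^nat) (s : R) : lacunary n -> 2 <= s ->
  exists2 C : R, 0 < C & forall a, H1_atom a ->
    (\int[mu]_x variation_operator s n a x <= C%:E)%E.
Proof.
move=> ln s2; have n0 k := lacunary_gt0 k ln.
have [q q01 nq] := lacunary_ratio ln; have /andP[q0 q1] := q01.
have [B B0 sqB] := lacunary_square_function_bound ln.
have q10 : 0 < (1 - q)^-1 by rewrite invr_gt0 subr_gt0.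
(* 2 is the mass of the indicator near the support, [B] bounds the square function, and the
   tails of both ends of the differences contribute [(1 - q)^-1] each. *)
exists (2 + (B + ((1 - q)^-1 + (1 - q)^-1))); first by rewrite !addr_gt0.
move=> a' /H1_atom_bounded[u [v [a [uv atom aa]]]].
have -> : variation_operator s n a' = variation_operator s n a.
  apply/funext => x; rewrite !variation_operatorE; congr lnorm.
  by apply/funext => k; rewrite /avg_diff !aa.
have ba := bcs_bounded_atom atom; pose L := v - u.
have L0 : 0 < L by rewrite subr_gt0.
have DE k : avg_diff n a ^~ k = conv (diff_kernel n k) a.
  rewrite /diff_kernel (convBl (bcs_avg _) (bcs_avg _) ba).
  by apply/funext => x; rewrite /avg_diff !(backward_average_avg _ ba).
have bD k : bcs (avg_diff n a ^~ k) by rewrite DE; apply: bcs_conv => //; exact: bcs_diff_kernel.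
have bD2 k : bcs (fun x => avg_diff n a x k ^+ 2).
  by under eq_fun do rewrite expr2; exact: bcsM.
have bt k : bcs (atom_tail u v (n k)) by exact: bcs_atom_tail.
have bM k : bcs (atom_majorant u v a n k).
  by apply: bcsD; [exact: bcsZ|exact: bcsD].
have M0 k x : (0 <= (atom_majorant u v a n k x)%:E)%E.
  by rewrite lee_fin; exact: atom_majorant_ge0.
have b1 := bcsZ L^-1 (bcs_indic_itv u (v + L)).
apply: (@le_trans _ _ (\int[mu]_x ((L^-1 * \1_(`[u, v + L]%classic) x)%:E +
    \sum_(k <oo) (atom_majorant u v a n k x)%:E))%E).
  apply: ge0_le_integral => //.
  - by move=> x _; exact: poweR_ge0.
  - by apply: measurable_variation_operator; exact: bcs_meas.
  - apply: emeasurable_funD; first by apply/measurable_EFinP; exact: bcs_meas.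
    apply: ge0_emeasurable_sum => // k _; apply/measurable_EFinP; exact: bcs_meas.
  - by move=> x _; exact: variation_atom_le.
rewrite ge0_integralD//; last 4 first.
- by move=> x _; rewrite lee_fin mulr_ge0 ?invr_ge0 ?(ltW L0)// indicE ler0n.
- by apply/measurable_EFinP; exact: bcs_meas.
- by move=> x _; apply: nneseries_ge0.
- by apply: ge0_emeasurable_sum => // k _; apply/measurable_EFinP; exact: bcs_meas.
rewrite EFinD; apply: leeD.
  rewrite integral_bcs// RintegralZl//; last exact: bcs_integrable (bcs_indic_itv _ _).
  rewrite Rintegral_indic_itv; last by move: uv L0; rewrite /L; lra.
  by rewrite lee_fin (_ : v + L - u = 2 * L) 1?mulrCA ?mulVf ?lt0r_neq0 ?mulr1// /L; ring.
rewrite integral_nneseries//; last by move=> k; apply/measurable_EFinP; exact: bcs_meas.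
apply: nneseries_le => [k|K]; first exact: integral_ge0.
under eq_bigr do rewrite integral_bcs//.
rewrite sumEFin lee_fin.
have -> : \sum_(k < K) \int[mu]_x atom_majorant u v a n k x =
  L * \sum_(k < K) \int[mu]_x (conv (diff_kernel n k) a x ^+ 2) +
  (\sum_(k < K) (L < n k.+1)%R%:R * ((n k.+1)^-1 * L) +
   \sum_(k < K) (L < n k)%R%:R * ((n k)^-1 * L)).
  rewrite mulr_sumr -!big_split/=; apply: eq_bigr => k _.
  have /= -> := RintegralD measurableT (bcs_integrable (bcsZ L (bD2 k)))
    (bcs_integrable (bcsD (bt k.+1) (bt k))).
  have /= -> := RintegralD measurableT (bcs_integrable (bt k.+1)) (bcs_integrable (bt k)).
  rewrite !Rintegral_atom_tail//; congr (_ + _).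
  rewrite RintegralZl//; last exact: bcs_integrable (bD2 k).
  by rewrite -DE.
have nqS k : n k <= q * n k.+1 by have := nq k k.+1 (leqnSn k); rewrite subSnn expr1.
apply: lerD; last apply: lerD.
- have := sqB a K ba; have := Rintegral_atom_sqr uv atom; rewrite -/L.
  move: (\int[mu]_t _) (\sum_(k < K) _) => I S IL SI.
  apply: (@le_trans _ _ (L * (B * L^-1))); last by rewrite mulrCA mulfV ?mulr1// lt0r_neq0.
  by rewrite ler_pM2l// (le_trans SI)// ler_pM2l.
- have := lacunary_sum_inv_le K.+1 q01 L0 n0 nqS.
  rewrite big_ord_recl/=; apply: le_trans; rewrite lerDr mulr_ge0 ?ler0n//.
  by rewrite mulr_ge0 ?invr_ge0 ?(ltW L0) ?(ltW (n0 _)).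
- exact: lacunary_sum_inv_le.
Qed.

End atoms.

(** * Summation over an atomic decomposition *)

Section sequence_norm_triangle.
Context {R : realType}.
Implicit Types (d : nat -> R) (s : R).

Lemma lnorm_ge0 s d : (0 <= lnorm s d)%E.
Proof. exact: poweR_ge0. Qed.

Lemma sum_le_lnorm s d (W : R) K : 0 < s -> 0 <= W -> (lnorm s d <= W%:E)%E ->
  \sum_(k < K) `|d k| `^ s <= W `^ s.
Proof.
move=> s0 W0 dW; have S0 : (0 <= \sum_(k <oo) (`|d k| `^ s)%:E)%E.
  by apply: nneseries_ge0 => k _ _; rewrite lee_fin powR_ge0.
rewrite -lee_fin -sumEFin -(big_mkord xpredT (fun k => (`|d k| `^ s)%:E)).
apply: (@le_trans _ _ (\sum_(k <oo) (`|d k| `^ s)%:E)%E).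
  by apply: nneseries_lim_ge => k _ _; rewrite lee_fin powR_ge0.
rewrite -[leLHS]poweRe1// -(mulVf (lt0r_neq0 s0)) poweRrM -poweR_EFin.
apply: gt0_ler_poweR => //; first exact: ltW.
  by rewrite in_itv/= leey andbT poweR_ge0.
by rewrite in_itv/= leey andbT lee_fin.
Qed.

Lemma lnorm_counting s d : 0 < s -> lnorm s d = ('N[@counting nat R]_(s%:E) [EFin \o d])%E.
Proof. by move=> s0; rewrite Lnorm_counting. Qed.

Lemma lnormD s d1 d2 : 1 <= s ->
  (lnorm s (fun k => (d1 k + d2 k)%R) <= lnorm s d1 + lnorm s d2)%E.
Proof.
move=> s1; have s0 : 0 < s by exact: lt_le_trans s1.
by rewrite !lnorm_counting//; exact: minkowski_EFin.
Qed.

Lemma lnormZ s (c : R) d : 0 < s -> lnorm s (fun k => c * d k) = (`|c|%:E * lnorm s d)%E.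
Proof.
move=> s0; rewrite /lnorm.
have -> : (\sum_(k <oo) (`|c * d k| `^ s)%:E = (`|c| `^ s)%:E * \sum_(k <oo) (`|d k| `^ s)%:E)%E.
  rewrite -nneseriesZl; last by move=> k _; rewrite lee_fin powR_ge0.
  by apply: eq_eseriesr => k _; rewrite normrM powRM// EFinM.
rewrite poweRM ?lee_fin ?powR_ge0//; last first.
  by apply: nneseries_ge0 => k _ _; rewrite lee_fin powR_ge0.
by rewrite poweR_EFin -powRrM mulfV ?lt0r_neq0// powRr1.
Qed.

Lemma lnorm_sum s (lam : nat -> R) (d : nat -> nat -> R) N : 1 <= s ->
  (lnorm s (fun k => (\sum_(j < N) lam j * d j k)%R) <=
   \sum_(j < N) `|lam j|%:E * lnorm s (d j))%E.
Proof.
move=> s1; have s0 : 0 < s by exact: lt_le_trans s1.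
elim: N => [|N IH].
  rewrite big_ord0; apply: (lnorm_le (W := 0)) => // K.
  by rewrite powR0 ?gt_eqF// big1// => k _; rewrite big_ord0 normr0 powR0 ?gt_eqF.
rewrite big_ord_recr/=; under eq_fun do rewrite big_ord_recr/=.
by apply: le_trans (lnormD _ _ s1) _; rewrite leeD// lnormZ.
Qed.

(** The closed balls of l^s are closed under uniform approximation. *)
Lemma lnorm_approx s d (W : \bar R) : 1 <= s ->
  (forall e : R, 0 < e -> exists2 d', (lnorm s d' <= W)%E & forall k, `|d k - d' k| <= e) ->
  (lnorm s d <= W)%E.
Proof.
move=> s1 dW; have s0 : 0 < s by exact: lt_le_trans s1.
have W0 : (0 <= W)%E.
  by have [d' + _] := dW 1 ltr01; apply: le_trans; exact: lnorm_ge0.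
case: W W0 dW => [w| |]// W0 dW; last exact: leey.
rewrite lee_fin in W0; apply: lnorm_le => // K.
(* Truncation to [K] terms makes a uniformly small sequence small in norm. *)
pose tr d k : R := if (k < K)%N then d k else 0.
have trd : (lnorm s (tr d) <= w%:E)%E.
  apply/lee_addgt0Pr => e e0.
  have [|d' d'W dd'] := dW (e / K.+1%:R); first by rewrite divr_gt0.
  have -> : tr d = fun k => tr d' k + tr (fun k => d k - d' k) k.
    by apply/funext => k; rewrite /tr; case: ifP => _; rewrite ?subrKC ?addr0.
  apply: le_trans (lnormD _ _ s1) _; apply: leeD.
    apply: lnorm_le => // K'; apply: le_trans (sum_le_lnorm K' s0 W0 d'W).
    apply: ler_sum => k _; rewrite /tr; case: ifP => // _.
    by rewrite normr0 powR0 ?powR_ge0 ?gt_eqF.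
  apply: le_trans (lnorm_nonincreasing _ ltr01 s1) _.
  apply: lnorm_le => [//||K']; first exact: ltW.
  rewrite [leRHS]powRr1 ?(ltW e0)//.
  apply: (@le_trans _ _ ((minn K K')%:R * (e / K.+1%:R))); last first.
    rewrite mulrCA ler_piMr ?(ltW e0)// ler_pdivrMr// mul1r ler_nat.
    by rewrite (leq_trans (geq_minl _ _)).
  elim: K' => [|K' IH]; first by rewrite big_ord0 minn0 mul0r.
  rewrite big_ord_recr/= powRr1// [tr _ K']/tr.
  have [KK'|K'K] := leqP K K'.
    rewrite normr0 addr0 (minn_idPl (leqW KK')).
    by move: IH; rewrite (minn_idPl KK').
  move: IH; rewrite (minn_idPr K'K) (minn_idPr (ltnW K'K)) -[K'.+1%:R]natr1 mulrDl mul1r => IH.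
  exact: lerD.
have := sum_le_lnorm K s0 W0 trd; apply: le_trans.
by apply: ler_sum => k _; rewrite /tr ltn_ord.
Qed.

End sequence_norm_triangle.

Section hardy.
Context {R : realType}.
Local Notation mu := (@lebesgue_measure R).
Implicit Types (f g a : R -> R) (r s : R) (n : R^nat).

Lemma H1_atom_integrable a : H1_atom a -> mu.-integrable setT (EFin \o a).
Proof.
move=> [ma [u [v [uv a0 aN aI]]]].
apply/integrableP; split; first exact/measurable_EFinP.
move: aN; rewrite unlock lebesgue_measure_setT_gt0 => /ess_supP aN.
have bi := bcsZ (v - u)^-1 (bcs_indic_itv u v).
apply: (@le_lt_trans _ _ (\int[mu]_x ((v - u)^-1 * \1_(`[u, v]%classic) x)%:E)%E); last first.
  by rewrite integral_bcs// ltry.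
apply: ae_ge0_le_integral => //.
- by apply: measurableT_comp => //; exact/measurable_EFinP.
- by move=> x _; rewrite lee_fin mulr_ge0 ?invr_ge0 ?subr_ge0 ?(ltW uv)// indicE ler0n.
- by apply/measurable_EFinP; exact: bcs_meas.
apply: filterS aN => x /= + _; rewrite !lee_fin indicE mem_setE.
by case: (boolP (x \in `[u, v])) => [_|/a0 ->]; rewrite ?mulr1// normr0 mulr0.
Qed.

Lemma integrableDZ f g (c : R) : mu.-integrable setT (EFin \o f) ->
  mu.-integrable setT (EFin \o g) -> mu.-integrable setT (EFin \o (fun x => f x + c * g x)).
Proof.
move=> fi gi; have := integrableD measurableT fi (integrableZl measurableT c gi).
by congr (_.-integrable _ _).
Qed.

Lemma integrable_sumZ (lam : nat -> R) (a : nat -> R -> R) N :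
  (forall j, mu.-integrable setT (EFin \o a j)) ->
  mu.-integrable setT (EFin \o (fun x => \sum_(0 <= j < N) lam j * a j x)).
Proof.
move=> ai; elim: N => [|N IH].
  have := bcs_integrable (@bcs0 R); congr (_.-integrable _ _).
  by apply/funext => x /=; rewrite big_geq.
have := integrableDZ (lam N) IH (ai N); congr (_.-integrable _ _).
by apply/funext => x /=; rewrite big_nat_recr.
Qed.

Lemma backward_averageDZ r f g (c x : R) : mu.-integrable setT (EFin \o f) ->
  mu.-integrable setT (EFin \o g) ->
  backward_average r (fun y => f y + c * g y) x =
  backward_average r f x + c * backward_average r g x.
Proof.
move=> fi gi; have fgi := integrableDZ c fi gi.
rewrite !backward_average_conv ?integrable_measurable//; try exact: integrable_measurable.
rewrite mulrCA -mulrDr; congr (_ * _).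
have f1 := integrable_conv_indic 0 r x fi; have g1 := integrable_conv_indic 0 r x gi.
rewrite /conv -RintegralZl//.
have /= <- := RintegralD measurableT f1 (integrableZl measurableT c g1).
by apply: eq_Rintegral => t _; rewrite mulrDl mulrA.
Qed.

Lemma avg_diffDZ n f g (c x : R) k : mu.-integrable setT (EFin \o f) ->
  mu.-integrable setT (EFin \o g) ->
  avg_diff n (fun y => f y + c * g y) x k = avg_diff n f x k + c * avg_diff n g x k.
Proof. by move=> fi gi; rewrite /avg_diff !backward_averageDZ//; ring. Qed.

Lemma avg_diff_sumZ n (lam : nat -> R) (a : nat -> R -> R) N x k :
  (forall j, mu.-integrable setT (EFin \o a j)) ->
  avg_diff n (fun y => \sum_(0 <= j < N) lam j * a j y) x k =
  \sum_(j < N) lam j * avg_diff n (a j) x k.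
Proof.
move=> ai; elim: N => [|N IH].
  rewrite big_ord0 /avg_diff /backward_average.
  have z r : \int[mu]_(t in `[0, r]) (\sum_(0 <= j < 0) lam j * a j (x - t)) = 0.
    rewrite -[RHS](mul0r (fine (mu `[0, r]%classic))) -Rintegral_cst//.
    by apply: eq_Rintegral => t _; rewrite big_geq.
  by rewrite !z !mulr0 subrr.
rewrite big_ord_recr/= -IH -avg_diffDZ//; last exact: integrable_sumZ.
congr (avg_diff n _ x k); apply/funext => y; rewrite big_nat_recr//.
Qed.

(** At each point the averages depend continuously on the function in L^1, so the variation at
    [x] of a sum converging in L^1 is at most the sum of the variations. *)
Lemma variation_atomic_decomposition n s f (lam : R^nat) (a : nat -> R -> R) x :
  lacunary n -> 2 <= s -> mu.-integrable setT (EFin \o f) ->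
  atomic_decomposition f lam a ->
  (variation_operator s n f x <= \sum_(j <oo) `|lam j|%:E * variation_operator s n (a j) x)%E.
Proof.
move=> ln s2 fi [atoms cvg].
have n0 k := lacunary_gt0 k ln; have s1 : 1 <= s by apply: le_trans s2; rewrite ler1n.
have ai j : mu.-integrable setT (EFin \o a j) by exact: H1_atom_integrable.
rewrite variation_operatorE; apply: lnorm_approx => // e e0.
have nn k : (n k)^-1 <= (n 0%N)^-1.
  rewrite lef_pV2 ?posrE//; elim: k => // k /le_trans; apply.
  by have [/increasing_seqP h _] := ln; exact/ltW.
pose F N y := \sum_(0 <= j < N) lam j * a j y.
(* All averages at [x] are bounded by [(n 0)^-1] times the L^1 norm, and each difference
   involves two of them. *)
have [N FN] : exists N, \int[mu]_y `|f y - F N y| <= e / (2 * (n 0%N)^-1).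
  have e'0 : 0 < e / (2 * (n 0%N)^-1) by rewrite divr_gt0 ?mulr_gt0 ?invr_gt0.
  move/fine_cvgP : cvg => [_ /cvgr0Pnorm_lt/(_ _ e'0)] [N _ hN].
  exists N; have /= := hN N (leqnn N); rewrite Lnorm1 => /ltW; apply: le_trans.
  exact: ler_norm.
have Fi := integrable_sumZ lam N ai.
exists (avg_diff n (F N) x).
  rewrite (_ : avg_diff _ _ _ = fun k => \sum_(j < N) lam j * avg_diff n (a j) x k); last first.
    by apply/funext => k; exact: avg_diff_sumZ.
  apply: le_trans (lnorm_sum lam (fun j => avg_diff n (a j) x) N s1) _.
  under eq_bigr do rewrite -variation_operatorE.
  pose U j := (`|lam j|%:E * variation_operator s n (a j) x)%E.
  rewrite -(big_mkord xpredT U).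
  apply: (@nneseries_lim_ge R U xpredT 0%N N) => j _ _.
  by rewrite mule_ge0//; exact: poweR_ge0.
move=> k.
rewrite (_ : _ - _ = avg_diff n (fun y => f y + -1 * F N y) x k); last first.
  by rewrite avg_diffDZ// mulN1r.
have gi := integrableDZ (-1) fi Fi.
rewrite /avg_diff (le_trans (ler_normB _ _))//.
have hb l : `|backward_average (n l) (fun y => f y + -1 * F N y) x| <= e / 2.
  apply: le_trans (norm_backward_average_le x (n0 l) gi) _.
  apply: (@le_trans _ _ ((n 0%N)^-1 * (e / (2 * (n 0%N)^-1)))).
    apply: ler_pM => //; first by rewrite invr_ge0 ltW.
      exact: Rintegral_ge0.
    by apply: le_trans FN; rewrite le_eqVlt; apply/orP; left; apply/eqP;
      apply: eq_Rintegral => y _; rewrite mulN1r.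
  by rewrite le_eqVlt; apply/orP; left; apply/eqP; field; rewrite lt0r_neq0.
by have := hb k; have := hb k.+1; lra.
Qed.

End hardy.

Theorem theorem1 (R : realType) (s : R) (n : R^nat) :
  2 <= s -> lacunary n ->
  exists2 C : R, 0 < C &
    forall f : R -> R, in_H1 f ->
      ('N[lebesgue_measure]_1 [variation_operator s n f] <= C%:E * H1_norm f)%E.
Proof.
move=> s2 ln; have [C C0 atomC] := integral_variation_atom_le ln s2.
exists C => // f [fi _].
rewrite -lee_pdivrMl//; apply: le_ereal_inf_tmp => _ [lam [a [dec ->]]].
rewrite lee_pdivrMl// Lnorm1.
have [atoms _] := dec.
have V0 g x : (0 <= variation_operator s n g x)%E by exact: poweR_ge0.
have mV g : lebesgue_measure.-integrable setT (EFin \o g) ->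
    measurable_fun [set: R] (variation_operator s n g).
  by move=> gi; apply: measurable_variation_operator; exact: integrable_measurable.
have mVa j : measurable_fun [set: R] (variation_operator s n (a j)).
  by apply: mV; exact: H1_atom_integrable.
have mlV j : measurable_fun [set: R] (fun x => `|lam j|%:E * variation_operator s n (a j) x)%E.
  exact: measurable_funeM.
have lV0 j x : (0 <= `|lam j|%:E * variation_operator s n (a j) x)%E by rewrite mule_ge0.
under eq_integral do rewrite gee0_abs//.
apply: (@le_trans _ _ (\int[lebesgue_measure]_x
    \sum_(j <oo) `|lam j|%:E * variation_operator s n (a j) x)%E).
  apply: ge0_le_integral => //; first exact: mV.
    by apply: ge0_emeasurable_sum => // j _; exact: mlV.
  by move=> x _; exact: variation_atomic_decomposition.
rewrite integral_nneseries//.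
rewrite -nneseriesZl//; apply: lee_nneseries => [j _ _|j _]; first exact: integral_ge0.
have -> : (\int[lebesgue_measure]_x (`|lam j|%:E * variation_operator s n (a j) x) =
    `|lam j|%:E * \int[lebesgue_measure]_x variation_operator s n (a j) x)%E.
  by apply: ge0_integralZl_EFin => //; exact: mVa.
rewrite [leLHS]muleC.
by apply: lee_wpmul2r; [rewrite lee_fin|exact: atomC].
Qed.
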